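(* Let $V$ be a normed vector space such that its unit ball is the closed convex hull of its extreme points. Let $A\subset V$ and let $\sigma$ be a conical bicombing on $A$ (with the metric induced by the norm). If $p_0\in A$ and $r\ge 0$ are such that $B_{2r}(p_0)\subset A$, then $\sigma(p,q,t)=(1-t)p+tq$ for all $p,q\in B_r(p_0)$ and all $t\in[0,1]$.
   Context: For $p\in V$ and $r\ge0$, $B_r(p):=\{q\in V:\|p-q\|\le r\}$ is the closed ball; the unit ball is $B_1(0)$. Let $(X,d)$ be a metric space. A (geodesic) bicombing on $X$ is a map $\sigma\colon X\times X\times[0,1]\to X$ such that, writing $\sigma_{pq}(t):=\sigma(p,q,t)$, for all $p,q\in X$ one has $\sigma_{pq}(0)=p$, $\sigma_{pq}(1)=q$, and $d(\sigma_{pq}(t),\sigma_{pq}(s))=|t-s|\cdot d(p,q)$ for all $s,t\in[0,1]$. The bicombing $\sigma$ is conical if $d(\sigma_{pq}(t),\sigma_{p'q'}(t))\le(1-t)\,d(p,p')+t\,d(q,q')$ for all $p,q,p',q'\in X$ and $t\in[0,1]$. *)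

(* Defs.v *)
From HB Require Import structures.
From mathcomp Require Import all_boot all_order all_algebra.
From mathcomp Require Import interval_inference.
From mathcomp Require Import all_classical all_reals all_analysis.

Set Implicit Arguments.
Unset Strict Implicit.
Unset Printing Implicit Defensive.

Import Order.TTheory GRing.Theory Num.Theory.
Import numFieldNormedType.Exports.

Local Open Scope classical_set_scope.
Local Open Scope ring_scope.

(* A subset of a normed space, viewed as a type, with the metric induced by
   the norm; its topology is the library's subspace topology on [set_type]. *)
Section set_type_metric.
Context {R : realType} {V : normedModType R} {A : set V}.

Let dist (x y : A) : R := `|val x - val y|.

Let dist_ge0 (x y : A) : 0 <= dist x y.
Proof. exact: normr_ge0. Qed.

Let dist_positivity (x y : A) : dist x y = 0 -> x = y.
Proof. by move=> /normr0_eq0/subr0_eq/val_inj. Qed.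

Let ballEdist (x : A) (d : R) : ball x d = [set y | dist x y < d].
Proof.
have -> : ball x d = [set y : A | ball (val x) d (val y)] by [].
by rewrite -ball_normE.
Qed.

HB.instance Definition _ := PseudoMetric_isMetric.Build R (set_type A)
  dist_ge0 dist_positivity ballEdist.

End set_type_metric.

Lemma mdist_set_typeE (R : realType) (V : normedModType R) (A : set V)
  (x y : A) : mdist x y = `|val x - val y|.
Proof. by []. Qed.

Definition extreme_points (R : numDomainType) (V : lmodType R) (K : set V) :
    set V :=
  [set x | K x /\ forall (y z : V) (t : R), K y -> K z -> 0 < t < 1 ->
    x = (1 - t) *: y + t *: z -> y = x /\ z = x].

Definition convex_hull (R : numDomainType) (V : lmodType R) (E : set V) :
    set V :=
  smallest (@convex_set R V) E.

Definition closed_convex_hull (R : realType) (V : normedModType R)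
    (E : set V) : set V :=
  closure (convex_hull E).

Definition is_bicombing (R : realType) (X : metricType R)
    (sigma : X -> X -> {i01 R} -> X) : Prop :=
  forall p q : X,
    [/\ sigma p q 0%:i01 = p,
        sigma p q 1%:i01 = q &
        forall t s : {i01 R},
          mdist (sigma p q t) (sigma p q s) = `|t%:num - s%:num| * mdist p q].

Definition conical (R : realType) (X : metricType R)
    (sigma : X -> X -> {i01 R} -> X) : Prop :=
  forall (p q p' q' : X) (t : {i01 R}),
    mdist (sigma p q t) (sigma p' q' t)
      <= (1 - t%:num) * mdist p p' + t%:num * mdist q q'.

(* The library's [closed_ball x r] is the closure of the open ball, which is
   empty for [r = 0]; [closed_ball_ Num.norm x r] is [{y | `|x - y| <= r}]. *)
Definition cball (R : realType) (V : normedModType R) (x : V) (r : R) :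
    set V :=
  closed_ball_ Num.norm x r.

(* Main.v *)
Require Import Defs.
From mathcomp Require Import all_boot all_order all_algebra.
From mathcomp Require Import interval_inference.
From mathcomp Require Import all_classical all_reals all_analysis.
From mathcomp Require Import ring lra.

Set Implicit Arguments.
Unset Strict Implicit.
Unset Printing Implicit Defensive.

Import Order.TTheory GRing.Theory Num.Theory.
Import numFieldNormedType.Exports.

Local Open Scope classical_set_scope.
Local Open Scope ring_scope.

(** Write E for the set of extreme points of the unit ball.  A point x with
    |a - x| <= t l and |(a + l e) - x| <= (1 - t) l is a point of parameter t
    on a geodesic from a to a + l e; when e belongs to E, the only such point
    is a + (t l) e, since x splits e into a convex combination of two vectors
    of the unit ball ([extreme_direction_unique_geodesic]).

    This uniqueness propagates to all finite sums d = l_1 e_1 + ... + l_n e_n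
    with e_i in E and l_i >= 0.  Let d = u + k e, and suppose that sigma is
    linear on pairs differing by u.  To find x = sigma_{p, p + d}(t), apply
    conicality against the linear geodesics p -> p + u and
    p + k e -> p + k e + u, which share one endpoint each with p -> p + d.
    This gives
      |(p + t u) - x| <= t k   and   |(p + k e + t u) - x| <= (1 - t) k,
    and the two reference points differ by k e, so that x = p + t d
    ([linear_along_cons]).

    All points at which sigma is evaluated in this induction lie in the
    ellipsoid {z | |z - p| + |z - q| <= l_1 + ... + l_n}, where q = p + d.  If
    p and q lie in B_r(p0) and the total weight is at most 2r, the ellipsoid
    is contained in B_{2r}(p0), hence in A ([ellipsoid_sub_cball]).

    Finally, q - p = 2r w with |w| <= 1, and w is a limit of elements of
    conv(E).  Pairs p', q' in B_r(p0) with q' - p' = 2r s c, c in conv(E) and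
    s <= 1 can thus be found arbitrarily close to p, q
    ([approx_pair_hull]), and sigma_{pq}(t) depends continuously on (p, q) by
    conicality. *)

(** * Extreme points and sums of extreme points *)

Section extreme_directions.
Context {R : realType} {V : normedModType R}.
Implicit Types (E : set V) (a e u v x z p q : V) (k l t r : R).

Lemma cball0E x r : cball (0 : V) r x = (`|x| <= r).
Proof. by rewrite /cball /closed_ball_ /= sub0r normrN. Qed.

Lemma cball_scale_inv x k : 0 < k -> `|x| <= k -> cball (0 : V) 1 (k^-1 *: x).
Proof.
move=> k0 xk; rewrite cball0E normrZ gtr0_norm ?invr_gt0//.
by rewrite ler_pdivrMl// mulr1.
Qed.

(** For 0 < t < 1, the vectors (x - a) / (t l) and (a + l e - x) / ((1 - t) l)
    lie in the unit ball, and their combination with weights t and 1 - t is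
    e; extremality forces both to be e. *)
Lemma extreme_direction_unique_geodesic e a x l t :
  extreme_points (cball (0 : V) 1) e -> 0 <= l -> 0 <= t <= 1 ->
  `|a - x| <= t * l -> `|a + l *: e - x| <= (1 - t) * l ->
  x = a + (t * l) *: e.
Proof.
move=> [_ ext] l0 /andP[t0 t1] ax aex.
have [tl0|tl_neq0] := eqVneq (t * l) 0.
  move: ax; rewrite tl0 normr_le0 subr_eq0 => /eqP->.
  by rewrite scale0r addr0.
have [sl0|sl_neq0] := eqVneq ((1 - t) * l) 0.
  move: aex; rewrite sl0 normr_le0 subr_eq0 => /eqP <-.
  by congr (_ + _ *: _); move: sl0; lra.
have tl_gt0 : 0 < t * l by rewrite lt0r tl_neq0 mulr_ge0.
have sl_gt0 : 0 < (1 - t) * l by rewrite lt0r sl_neq0 mulr_ge0 ?subr_ge0.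
have l_neq0 : l != 0 by apply: contraNneq tl_neq0 => ->; rewrite mulr0.
have t_neq0 : t != 0 by apply: contraNneq tl_neq0 => ->; rewrite mul0r.
have s_neq0 : 1 - t != 0 by apply: contraNneq sl_neq0 => ->; rewrite mul0r.
have st01 : 0 < 1 - t < 1.
  by rewrite lt0r s_neq0 subr_ge0 t1 gtrBl lt0r t_neq0.
have [| |//|y_eq _] := ext ((t * l)^-1 *: (x - a))
    (((1 - t) * l)^-1 *: (a + l *: e - x)) (1 - t) _ _ st01.
- by apply: cball_scale_inv; rewrite // distrC.
- exact: cball_scale_inv.
- rewrite !scalerA subKr !invfM !mulrA !mulfV// !mul1r -scalerDr.
  by rewrite addrC addrA subrK addrC addKr scalerA mulVf// scale1r.
by rewrite -{1}y_eq scalerA mulfV// scale1r subrKC.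
Qed.

(** The pairs (l_1 + ... + l_n, l_1 e_1 + ... + l_n e_n) with e_i in E and
    l_i >= 0.  The weight is recorded because it controls which points the
    induction on the number of summands visits. *)
Inductive weighted_sum E : R -> V -> Prop :=
| weighted_sum_nil : weighted_sum E 0 0
| weighted_sum_cons l k u e : 0 <= k -> E e -> weighted_sum E l u ->
    weighted_sum E (l + k) (u + k *: e).

Lemma weighted_sumD E l k u v :
  weighted_sum E l u -> weighted_sum E k v -> weighted_sum E (l + k) (u + v).
Proof.
move=> lu; elim=> [|k' m v' e m0 Ee _ IH]; first by rewrite !addr0.
by rewrite !addrA; exact: weighted_sum_cons.
Qed.

Lemma weighted_sumZ E k l u :
  0 <= k -> weighted_sum E l u -> weighted_sum E (k * l) (k *: u).
Proof.
move=> k_ge0; elim=> [|l' m u' e m0 Ee _ IH].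
  by rewrite mulr0 scaler0; exact: weighted_sum_nil.
by rewrite mulrDr scalerDr scalerA; apply: weighted_sum_cons; rewrite ?mulr_ge0.
Qed.

Lemma convex_hull_weighted_sum E v : convex_hull E v -> weighted_sum E 1 v.
Proof.
move: v; apply: smallest_sub => [|e Ee].
  move=> u v l /[!inE] Eu Ev.
  have -> : (1 : R) = l%:num * 1 + (1 - l%:num) * 1 by ring.
  by apply: weighted_sumD; apply: weighted_sumZ; rewrite ?subr_ge0.
have := weighted_sum_cons ler01 Ee (weighted_sum_nil E).
by rewrite !add0r scale1r.
Qed.

Definition ellipsoid p q l : set V := [set z | `|z - p| + `|z - q| <= l].

(** The average of the triangle inequalities through p and through q. *)
Lemma ellipsoid_sub_cball p0 p q r l : cball p0 r p -> cball p0 r q ->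
  l <= 2 * r -> ellipsoid p q l `<=` cball p0 (2 * r).
Proof.
rewrite /cball /closed_ball_ /= => pr qr lr z; rewrite /ellipsoid /= => zl.
have := ler_distD p p0 z; have := ler_distD q p0 z.
by rewrite [`|p - z|]distrC [`|q - z|]distrC; lra.
Qed.

Lemma ellipsoid_subr p q q' k l :
  `|q' - q| <= k -> ellipsoid p q' l `<=` ellipsoid p q (l + k).
Proof. by move=> qk z; rewrite /ellipsoid /=; have := ler_distD q' z q; lra. Qed.

Lemma ellipsoid_subl p p' q k l :
  `|p' - p| <= k -> ellipsoid p' q l `<=` ellipsoid p q (l + k).
Proof. by move=> pk z; rewrite /ellipsoid /=; have := ler_distD p' z p; lra. Qed.

End extreme_directions.

(** * Linearity of a conical bicombing along sums of extreme points *)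

Section conical_bicombing.
Context {R : realType} {V : normedModType R} {A : set V}.
Variable sigma : A -> A -> {i01 R} -> A.
Hypotheses (sigma_bicombing : is_bicombing sigma).
Hypotheses (sigma_conical : conical sigma).
Implicit Types (p q : A) (u v e : V) (k l : R) (t : {i01 R}).

Let conical_norm p q p' q' t :
  `|val (sigma p q t) - val (sigma p' q' t)| <=
  (1 - t%:num) * `|val p - val p'| + t%:num * `|val q - val q'|.
Proof. exact: sigma_conical. Qed.

Lemma bicombing_diag p t : sigma p p t = p.
Proof.
have [s0 _ /(_ t 0%:i01)] := sigma_bicombing p p.
rewrite s0 !mdist_set_typeE subrr normr0 mulr0.
by move=> /normr0_eq0/subr0_eq/val_inj.
Qed.

(** The bound |d| <= l is carried along so that the intermediate points p + u
    of the induction lie in the ellipsoid. *)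
Definition linear_along l d : Prop := `|d| <= l /\
  forall p q, val q = val p + d -> ellipsoid (val p) (val q) l `<=` A ->
  forall t, val (sigma p q t) = val p + t%:num *: d.

Lemma linear_along0 : linear_along 0 0.
Proof.
split=> [|p q]; first by rewrite normr0.
rewrite addr0 => /val_inj -> _ t.
by rewrite bicombing_diag scaler0 addr0.
Qed.

(** The geodesics p -> p + u and p + k e -> q each share one endpoint with
    p -> q, so conicality places sigma_{pq}(t) within t k of p + t u and within
    (1 - t) k of p + k e + t u.  Since these two points differ by k e,
    uniqueness in extreme directions locates sigma_{pq}(t) exactly.  The
    ellipsoids of weight l around both auxiliary pairs lie in the one of weight
    l + k around (p, q), which is why the domain condition is inherited. *)
Lemma linear_along_cons l k u e : 0 <= k ->
  extreme_points (cball (0 : V) 1) e ->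
  linear_along l u -> linear_along (l + k) (u + k *: e).
Proof.
move=> k0 ext [ul IH].
have ke : `|k *: e| <= k.
  have [+ _] := ext; rewrite cball0E => e1.
  by rewrite normrZ ger0_norm// ler_piMr.
split=> [|p q qE subA t].
  by rewrite (le_trans (ler_normD _ _))// lerD.
have pue : val p + u - val q = - (k *: e) by rewrite qE addrA opprD addNKr.
have pke : val p + k *: e - val q = - u.
  by rewrite qE [u + _]addrC addrA opprD addNKr.
have Ap1 : A (val p + u).
  by apply: subA; rewrite /ellipsoid /= addrAC subrr add0r pue normrN lerD.
have Ap2 : A (val p + k *: e).
  by apply: subA; rewrite /ellipsoid /= addrAC subrr add0r pke normrN addrC lerD.
pose p1 : A := SigSub (mem_set Ap1); pose p2 : A := SigSub (mem_set Ap2).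
have s1 : val (sigma p p1 t) = val p + t%:num *: u.
  apply: IH => //; apply: subset_trans subA; apply: ellipsoid_subr.
  by rewrite /= pue normrN.
have s2 : val (sigma p2 q t) = val p + k *: e + t%:num *: u.
  apply: IH; first by rewrite qE /= -addrA [k *: e + u]addrC.
  apply: subset_trans subA; apply: ellipsoid_subl.
  by rewrite /= addrAC subrr add0r.
rewrite (@extreme_direction_unique_geodesic _ _ e (val p + t%:num *: u)
  (val (sigma p q t)) k t%:num)//.
- by rewrite scalerDr scalerA addrA.
- by apply/andP; split.
- rewrite -s1.
  apply: (le_trans (conical_norm _ _ _ _ _)).
  by rewrite subrr normr0 mulr0 add0r /= pue normrN ler_wpM2l.
- rewrite [_ + k *: e]addrAC -s2.
  apply: (le_trans (conical_norm _ _ _ _ _)).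
  by rewrite subrr normr0 mulr0 addr0 /= addrAC subrr add0r ler_wpM2l//.
Qed.

Lemma linear_along_weighted_sum l d :
  weighted_sum (extreme_points (cball (0 : V) 1)) l d -> linear_along l d.
Proof.
elim=> [|l' k u e k0 ext _]; first exact: linear_along0.
exact: linear_along_cons.
Qed.

End conical_bicombing.

(** * Approximation by pairs differing by a sum of extreme points *)

(** With w = (q - p) / 2r in the unit ball and c in conv(E) within d of w, the
    shrinking factor s = 1 / (1 + 2d) compensates for the error c - w, so that
    q' = p' + 2rs c still lies in B_r(p0). *)
Lemma approx_pair_hull (R : realType) (V : normedModType R) (E : set V)
    (p0 p q : V) (r d : R) :
  cball (0 : V) 1 `<=` closed_convex_hull E ->
  0 < r -> 0 < d -> cball p0 r p -> cball p0 r q ->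
  exists (s : R) (c : V), let p' := p0 + s *: (p - p0) in
    let q' := p' + (2 * r * s) *: c in
    [/\ 0 <= s <= 1, convex_hull E c, cball p0 r p' /\ cball p0 r q',
        `|p - p'| <= 2 * r * d & `|q - q'| <= 4 * r * d].
Proof.
rewrite /cball /closed_ball_ /= => hull r0 d0 pr qr.
have r2_gt0 : 0 < 2 * r by rewrite mulr_gt0.
have r2_neq0 : 2 * r != 0 by rewrite gt_eqF.
pose w := (2 * r)^-1 *: (q - p).
have [|c [Ec wc]] := hull w _ _ (nbhsx_ballx w d d0).
  apply: cball_scale_inv => //.
  by have := ler_distD p0 q p; rewrite [`|q - p0|]distrC; lra.
have {}wc : `|c - w| <= d.
  by rewrite distrC ltW//; move: wc; rewrite -ball_normE.
pose s := (1 + 2 * d)^-1.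
have s0 : 0 < s by rewrite invr_gt0; lra.
have sE : s * (1 + 2 * d) = 1 by rewrite mulVf// gt_eqF//; lra.
have s1 : s <= 1 by have := mulr_gt0 s0 d0; lra.
have sd : (1 - s) * r <= 2 * r * d.
  suff : (1 - s) * r <= (2 * d) * r by lra.
  rewrite ler_pM2r//; have := mulr_ge0 (ltW d0) (_ : 0 <= 1 - s); lra.
exists s, c; set p' := p0 + s *: (p - p0); set q' := p' + _.
have p'E : p0 - p' = s *: (p0 - p).
  by rewrite /p' opprD addNKr -scalerN opprB.
have q'E : p0 - q' = s *: (p0 - q) - (2 * r * s) *: (c - w).
  rewrite /q' opprD addrA p'E.
  have -> : s *: (p0 - p) = s *: (p0 - q) + (2 * r * s) *: w.
    rewrite /w scalerA mulrAC mulfV// mul1r -scalerDr.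
    by rewrite addrA subrK.
  by rewrite -addrA -scalerBr -scalerN opprB.
have wc' : `|(2 * r * s) *: (c - w)| <= 2 * r * s * d.
  rewrite normrZ gtr0_norm ?mulr_gt0// ler_wpM2l//.
  by rewrite mulr_ge0 ?ltW.
have sq : `|s *: (p0 - q)| <= s * r by rewrite normrZ gtr0_norm// ler_pM2l.
have sr : s * r + 2 * r * s * d = r.
  by transitivity (s * (1 + 2 * d) * r); [ring | rewrite sE mul1r].
split=> //.
- by rewrite s1 ltW.
- split.
    rewrite p'E normrZ gtr0_norm// (@le_trans _ _ (s * r))//.
      by rewrite ler_pM2l.
    by rewrite ler_piMl// ltW.
  by rewrite q'E (le_trans (ler_normB _ _))//; lra.
- have -> : p - p' = (1 - s) *: (p - p0).
    by rewrite /p' opprD addrA scalerBl scale1r.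
  rewrite normrZ ger0_norm ?subr_ge0// distrC.
  by rewrite (le_trans _ sd)// ler_wpM2l// subr_ge0.
- have -> : q - q' = (1 - s) *: (q - p0) - (2 * r * s) *: (c - w).
    have -> : q - q' = (q - p0) + (p0 - q') by rewrite addrA subrK.
    by rewrite q'E addrA -(opprB q p0) scalerN scalerBl scale1r.
  rewrite (le_trans (ler_normB _ _))//.
  have : `|(1 - s) *: (q - p0)| <= 2 * r * d.
    rewrite normrZ ger0_norm ?subr_ge0// distrC.
    by rewrite (le_trans _ sd)// ler_wpM2l// subr_ge0.
  have : 2 * r * s * d <= 2 * r * d.
    by rewrite ler_pM2r// ler_piMr// ltW.
  lra.
Qed.

(** * Conical bicombings are linear on balls *)

Theorem theorem1p4 (R : realType) (V : normedModType R)
    (unit_ball_hull :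
      cball (0 : V) 1 = closed_convex_hull (extreme_points (cball (0 : V) 1)))
    (A : set V) (sigma : A -> A -> {i01 R} -> A)
    (sigma_bicombing : is_bicombing sigma) (sigma_conical : conical sigma)
    (p0 : V) (p0A : A p0) (r : R) (r_ge0 : 0 <= r)
    (ball_sub : cball p0 (2 * r) `<=` A) :
  forall p q : A, cball p0 r (val p) -> cball p0 r (val q) ->
  forall t : {i01 R},
    val (sigma p q t) = (1 - t%:num) *: val p + t%:num *: val q.
Proof.
move=> p q pr qr t.
(* The approximation rescales by 1 / 2r, so r = 0 is treated apart. *)
have [r_eq0|r_neq0] := eqVneq r 0.
  have center (x : A) : cball p0 r (val x) -> val x = p0.
    by rewrite /cball /closed_ball_ /= r_eq0 normr_le0 subr_eq0 => /eqP.
  have -> : q = p by apply: val_inj; rewrite (center _ pr) (center _ qr).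
  by rewrite bicombing_diag// -scalerDl subrK scale1r.
have r_gt0 : 0 < r by rewrite lt0r r_neq0.
have conical_norm (p' q' : A) : `|val (sigma p q t) - val (sigma p' q' t)| <=
  (1 - t%:num) * `|val p - val p'| + t%:num * `|val q - val q'|.
  exact: sigma_conical.
have t1 : 0 <= 1 - t%:num by rewrite subr_ge0.
set y := (X in _ = X).
apply/eqP; rewrite -subr_eq0 -normr_le0; apply/ler_addgt0Pl => eps eps0.
(* Both endpoints then move by at most 4 r d = eps / 2, and conicality
   transfers this bound to sigma. *)
rewrite addr0; pose d := eps / (8 * r).
have d0 : 0 < d by rewrite divr_gt0// mulr_gt0.
have /seteqP[hull _] := unit_ball_hull.
have [s [c /=]] := approx_pair_hull hull r_gt0 d0 pr qr.
set p' := _ + s *: _; set q' := p' + _ => -[/andP[s0 s1] Ec [p'r q'r] pp' qq'].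
have r2r : cball p0 r `<=` cball p0 (2 * r).
  by move=> z; rewrite /cball /closed_ball_ /= => zr; lra.
pose Ap' : A := SigSub (mem_set (ball_sub _ (r2r _ p'r))).
pose Aq' : A := SigSub (mem_set (ball_sub _ (r2r _ q'r))).
have r2s0 : 0 <= 2 * r * s by rewrite !mulr_ge0.
have [_ lin] := linear_along_weighted_sum sigma_bicombing sigma_conical
  (weighted_sumZ r2s0 (convex_hull_weighted_sum Ec)).
have {lin} sE : val (sigma Ap' Aq' t) = (1 - t%:num) *: p' + t%:num *: q'.
  rewrite (lin Ap' Aq' erefl).
    by rewrite /q' [_ *: (p' + _)]scalerDr addrA -scalerDl subrK scale1r.
  apply: (subset_trans _ ball_sub); apply: ellipsoid_sub_cball => //.
  by rewrite mulr1 ler_piMr// ltW// mulr_gt0.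
have bound : (1 - t%:num) * `|val p - p'| + t%:num * `|val q - q'| <= eps / 2.
  have -> : eps / 2 = (1 - t%:num) * (4 * r * d) + t%:num * (4 * r * d).
    by rewrite /d; field.
  rewrite lerD// ler_wpM2l//; apply: (le_trans pp').
  by have := mulr_gt0 r_gt0 d0; lra.
have yE : `|(1 - t%:num) *: p' + t%:num *: q' - y| <= eps / 2.
  apply: le_trans bound; rewrite /y opprD addrACA -!scalerBr.
  rewrite (le_trans (ler_normD _ _))// !normrZ !ger0_norm//.
  by rewrite [`|p' - _|]distrC [`|q' - _|]distrC.
have := conical_norm Ap' Aq'; rewrite sE => /le_trans/(_ bound) sig.
have := ler_distD ((1 - t%:num) *: p' + t%:num *: q') (val (sigma p q t)) y.
by lra.
Qed.
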